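(* Let $G$ be a connected (finite simple) graph. Then $G$ is closed if and only if $G$ is chordal, claw-free, and has no induced subgraph isomorphic to $H_1$ or to $H_2$.
   Context: All graphs are finite and simple. A graph $G$ with $n$ vertices is called closed if there exists a labeling of its vertices by $1,\dots,n$ (a bijection with $[n]=\{1,\dots,n\}$) such that: for any $i<j<k$ or $i>j>k$, if $\{i,j\}$ and $\{i,k\}$ are edges of $G$, then $\{j,k\}$ is an edge of $G$. A graph is chordal if it has no induced cycle of length greater than $3$. A graph is claw-free if it has no induced subgraph isomorphic to the graph on $\{1,2,3,4\}$ with edges $\{1,2\},\{1,3\},\{1,4\}$. The graph $H_1$ has six vertices $a,b,c,a',b',c'$ and the six edges $\{a,b\},\{a,c\},\{b,c\},\{a,a'\},\{b,b'\},\{c,c'\}$ (a triangle with one pendant edge attached at each of its vertices). The graph $H_2$ has six vertices $a,b,c,u,v,w$ and the nine edges $\{a,b\},\{a,c\},\{b,c\},\{u,a\},\{u,b\},\{v,a\},\{v,c\},\{w,b\},\{w,c\}$ (a triangle with a further triangle glued along each of its three edges). *)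

(* Defs.v *)
From mathcomp Require Import all_boot.

Set Implicit Arguments.
Unset Strict Implicit.
Unset Printing Implicit Defensive.

Record sgraph := SGraph {
  vertex :> finType;
  adj : rel vertex;
  adj_sym : symmetric adj;
  adj_irr : irreflexive adj
}.

Definition connected_graph (G : sgraph) : Prop :=
  forall x y : G, connect (@adj G) x y.

(* The label set {1, ..., n} is rendered as 'I_n = {0, ..., n - 1}; only the
   order of the labels matters. *)
Definition closed_labeling (G : sgraph) (l : G -> 'I_#|G|) : Prop :=
  bijective l /\
  forall x y z : G,
    (l x < l y < l z) || (l z < l y < l x) -> adj x y -> adj x z -> adj y z.

Definition closed_graph (G : sgraph) : Prop :=
  exists l : G -> 'I_#|G|, closed_labeling l.

Definition isomorphic (G H : sgraph) : Prop :=
  exists2 f : G -> H, bijective f & forall x y : G, adj (f x) (f y) = adj x y.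

Section Induced.
Variables (G : sgraph) (S : {set G}).

Definition induced_adj : rel {x : G | x \in S} :=
  fun x y => adj (val x) (val y).

Lemma induced_adj_sym : symmetric induced_adj.
Proof. by move=> x y; apply: adj_sym. Qed.

Lemma induced_adj_irr : irreflexive induced_adj.
Proof. by move=> x; apply: adj_irr. Qed.

Definition induced : sgraph := SGraph induced_adj_sym induced_adj_irr.
End Induced.

Definition has_induced (H G : sgraph) : Prop :=
  exists S : {set G}, isomorphic (induced S) H.

(* For n >= 3 this is the cycle of length n; the conjunct [i != j] only matters
   for n = 1. *)
Section Cycle.
Variable n : nat.

Definition cycle_adj : rel 'I_n :=
  fun i j => (i != j) && ((j == ordS i) || (i == ordS j)).

Lemma cycle_adj_sym : symmetric cycle_adj.
Proof. by move=> i j; rewrite /cycle_adj eq_sym orbC. Qed.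

Lemma cycle_adj_irr : irreflexive cycle_adj.
Proof. by move=> i; rewrite /cycle_adj eqxx. Qed.

Definition cycle_graph : sgraph := SGraph cycle_adj_sym cycle_adj_irr.
End Cycle.

Definition chordal (G : sgraph) : Prop :=
  forall n : nat, 3 < n -> ~ has_induced (cycle_graph n) G.

(* The graph on {0, ..., n - 1} whose edges are the unordered pairs listed
   in E. *)
Section EdgeList.
Variables (n : nat) (E : seq (nat * nat)).

Definition edges_adj : rel 'I_n :=
  fun i j => (i != j) &&
    (((val i, val j) \in E) || ((val j, val i) \in E)).

Lemma edges_adj_sym : symmetric edges_adj.
Proof. by move=> i j; rewrite /edges_adj eq_sym orbC. Qed.

Lemma edges_adj_irr : irreflexive edges_adj.
Proof. by move=> i; rewrite /edges_adj eqxx. Qed.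

Definition graph_of_edges : sgraph := SGraph edges_adj_sym edges_adj_irr.
End EdgeList.

Definition claw : sgraph := graph_of_edges 4 [:: (0, 1); (0, 2); (0, 3)].

Definition claw_free (G : sgraph) : Prop := ~ has_induced claw G.

(* a, b, c, a', b', c' = 0, 1, 2, 3, 4, 5 *)
Definition H1 : sgraph :=
  graph_of_edges 6 [:: (0, 1); (0, 2); (1, 2); (0, 3); (1, 4); (2, 5)].

(* a, b, c, u, v, w = 0, 1, 2, 3, 4, 5 *)
Definition H2 : sgraph :=
  graph_of_edges 6 [:: (0, 1); (0, 2); (1, 2); (3, 0); (3, 1); (4, 0); (4, 2);
                       (5, 1); (5, 2)].

(* Main.v *)
Require Import Defs.
From mathcomp Require Import all_boot zify.

Set Implicit Arguments.
Unset Strict Implicit.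
Unset Printing Implicit Defensive.

(** A closed labeling forces any two neighbours of a vertex that lie on the
same side of it to be equal or adjacent ([same_side]). So two distinct
non-adjacent neighbours of a vertex lie on different sides of it, which rules
out each forbidden graph: a claw has three leaves for two sides; the vertex of smallest
label of a cycle has both neighbours above it; in the net [H1] each vertex of
the triangle has its two triangle neighbours on the same side, and in the sun
[H2] on different sides, although a triangle has exactly one middle vertex.

Conversely, a closed labeling is read off from breadth-first search. If a root
[s] is such that every distance level is a clique, order the vertices by
distance from [s] and, inside a level, by increasing number of upper
neighbours and decreasing number of lower neighbours. Inside a level the upper
neighbourhoods are nested, and so are the lower ones, since an incomparable
pair gives an induced 4-cycle; and the two chains run in opposite directions,
since otherwise there is a claw. So the order has the umbrella property: if
[x] is adjacent to [z], every vertex between them is adjacent to both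
([before_umbrella]).

It remains to find the root. If [s] is simplicial and is not the nose of an
induced bull (the vertex of degree two in a triangle with pendant edges at its
two other vertices), then the levels from [s] are cliques by induction: two
non-adjacent vertices of a level, beyond the first, have, by claw-freeness,
distinct adjacent lower neighbours with a common lower neighbour [r], and this
is a bull with nose [s] if [r] is [s], and extends below [r] to a net if not
([levels_cliques]). Such an [s] is found at the far end of the graph: search
from a vertex [t] that is not adjacent to all others (without one the graph is
complete, and any labeling is closed), and take in the last level a vertex
with the fewest lower neighbours. The only use made of long induced cycles is
that the lower neighbours of two adjacent vertices of a level form a clique
([preds_near]): otherwise a shortest connection through smaller distances
would close an induced cycle. With this, the absence of suns and claws shows
that [s] is simplicial ([deepest_simplicial]) and not the nose of a bull
([deepest_not_nose]). *)

(** * Induced subgraphs as embeddings *)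

Definition near (G : sgraph) (x y : G) := (x == y) || adj x y.

Lemma near_sym (G : sgraph) : symmetric (@near G).
Proof. by move=> x y; rewrite /near eq_sym adj_sym. Qed.

Lemma near_adj (G : sgraph) (x y : G) : x != y -> near x y -> adj x y.
Proof. by rewrite /near => /negPf ->. Qed.

Lemma adj_neq (G : sgraph) (x y : G) : adj x y -> x != y.
Proof. by move=> xy; apply/eqP=> e; move: xy; rewrite e adj_irr. Qed.

Lemma has_inducedP (H G : sgraph) :
  has_induced H G <->
  exists2 f : H -> G, injective f & forall x y, adj (f x) (f y) = adj x y.
Proof.
split=> [[S [g [h gK hK] gE]]|[f f_inj fE]].
  exists (fun x => val (h x)) => [x y /val_inj|x y]; first exact: (can_inj hK).
  by rewrite -[x in RHS]hK -[y in RHS]hK gE.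
pose S := [set f x | x : H].
have inS x : f x \in S by apply: imset_f.
pose h x : induced S := Sub (f x) (inS x).
have hE x y : @adj (induced S) (h x) (h y) = adj x y by apply: fE.
have h_inj : injective h by move=> x y /(congr1 val) /f_inj.
have h_bij : bijective h.
  by apply: (inj_card_bij h_inj); rewrite card_sig card_imset.
case: h_bij => g hK gK; exists S, g; first by exists h.
by move=> x y; rewrite -hE !gK.
Qed.

Lemma cycle_adj_ltn n (i j : 'I_n) : i < j ->
  cycle_adj i j = (j == i.+1 :> nat) || (i == 0 :> nat) && (j.+1 == n).
Proof.
move=> ij; have jn := ltn_ord j; rewrite /cycle_adj.
have -> : i != j by rewrite -val_eqE /=; lia.
have -> : (j == ordS i) = (j == i.+1 :> nat).
  by rewrite -val_eqE /= modn_small //; lia.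
rewrite -(val_eqE i) /=; congr (_ || _).
have [e|ne] := eqVneq j.+1 n; first by rewrite e modnn andbT.
by rewrite modn_small ?andbF; [|move/eqP: ne]; lia.
Qed.

Definition listed_edge (E : seq (nat * nat)) i j :=
  (i != j) && (((i, j) \in E) || ((j, i) \in E)).

Lemma listed_edge_sym E i j : listed_edge E i j = listed_edge E j i.
Proof. by rewrite /listed_edge eq_sym orbC. Qed.

Lemma has_induced_edgesP (G : sgraph) n E :
  has_induced (graph_of_edges n.+1 E) G <->
  exists f : nat -> G,
    (forall i j, i < j < n.+1 -> f i != f j) /\
    (forall i j, i < j < n.+1 -> adj (f i) (f j) = listed_edge E i j).
Proof.
split=> [/has_inducedP[f f_inj fE]|[f [f_neq fE]]].
  exists (fun i => f (inord i)); split=> i j /andP[ij jn].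
    by rewrite (inj_eq f_inj) -val_eqE /= !inordK; lia.
  by rewrite fE /= /edges_adj -val_eqE /= !inordK //; lia.
apply/has_inducedP; exists (fun i : 'I_n.+1 => f i) => [i j fij|i j].
  apply/val_inj/eqP => /=; case: ltngtP => // ij.
    by have := f_neq i j; rewrite ij ltn_ord fij eqxx => /(_ isT).
  by have := f_neq j i; rewrite ij ltn_ord fij eqxx => /(_ isT).
rewrite /= /edges_adj -val_eqE /= -/(listed_edge E i j).
case: (ltngtP i j) => ij; first by apply: fE; rewrite ij ltn_ord.
  by rewrite adj_sym listed_edge_sym; apply: fE; rewrite ij ltn_ord.
by rewrite (val_inj ij) adj_irr /listed_edge eqxx.
Qed.

(** When no two vertices of the pattern have the same neighbours, a map that
preserves adjacency both ways is automatically injective; this holds for the net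
and the sun, but not for the claw. *)
Lemma has_induced_twin_free (G : sgraph) n E (f : nat -> G) :
  (forall i j, i < j < n.+1 ->
     has (fun k => listed_edge E i k != listed_edge E j k) (iota 0 n.+1)) ->
  (forall i j, i < j < n.+1 -> adj (f i) (f j) = listed_edge E i j) ->
  has_induced (graph_of_edges n.+1 E) G.
Proof.
move=> twin_free fE; apply/has_induced_edgesP; exists f; split=> // i j ijn.
have fE' a b : a < n.+1 -> b < n.+1 -> adj (f a) (f b) = listed_edge E a b.
  move=> an bn; case: (ltngtP a b) => ab; first by apply: fE; rewrite ab.
    by rewrite adj_sym listed_edge_sym; apply: fE; rewrite ab.
  by rewrite ab adj_irr /listed_edge eqxx.
have /hasP[k] := twin_free i j ijn; rewrite mem_iota /= => kn.
by apply: contraNneq => e; rewrite -!fE' ?e //; lia.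
Qed.

(** * Closed graphs contain no forbidden subgraph *)

Section Forbidden.
Variables (G : sgraph) (l : G -> 'I_#|G|).
Hypothesis cl : closed_labeling l.

Lemma label_inj : injective l. Proof. by case: cl => /bij_inj. Qed.

Lemma label_adj x y : adj x y -> (l y < l x) = ~~ (l x < l y).
Proof.
move=> /adj_neq; rewrite -leqNgt ltn_neqAle => xy.
by rewrite val_eqE (inj_eq label_inj) eq_sym xy.
Qed.

Lemma same_side c x y : adj c x -> adj c y ->
  (l c < l x) = (l c < l y) -> near x y.
Proof.
case: cl => _ clE cx cy e; rewrite /near; case: eqVneq => //= xy.
have ex := label_adj cx; have ey := label_adj cy.
have lxy: l x != l y :> nat by rewrite val_eqE (inj_eq label_inj).
have [lt_xy|] := boolP (if l c < l x then l x < l y else l y < l x).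
  by apply: (clE c) => //; move: lt_xy ex ey; rewrite -e; case: (l c < l x) => /=; lia.
move=> lt_xy; rewrite adj_sym.
by apply: (clE c) => //; move: lt_xy ex ey lxy; rewrite -e;
  case: (l c < l x) => /=; lia.
Qed.

Lemma opposite_side c x y : adj c x -> adj c y -> x != y -> ~~ adj x y ->
  (l c < l x) = ~~ (l c < l y).
Proof.
move=> cx cy xy nxy; have := same_side cx cy.
by rewrite /near (negPf xy) (negPf nxy); do 2 case: (_ < _) => //=; move=> /(_ erefl).
Qed.

(** The vertex of smallest label on the cycle has both its neighbours above it. *)
Lemma closed_chordal : chordal G.
Proof.
move=> n n3 /has_inducedP[f f_inj fE].
have n0 : 0 < n by lia.
case: (arg_minnP (fun i => l (f i)) (erefl true : predT (Ordinal n0))) => i _ imin.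
have adjS (j : 'I_n) : adj (f j) (f (ordS j)).
  rewrite fE /= /cycle_adj eqxx andbT -val_eqE /=.
  have := ltn_ord j; rewrite leq_eqVlt => /orP[/eqP e|jn].
    by rewrite e modnn; lia.
  by rewrite modn_small; lia.
have le_n (j : 'I_n) : nat_of_ord (ordS j) = if j.+1 == n then 0 else j.+1.
  have := ltn_ord j; rewrite leq_eqVlt /= => /orP[/eqP e|jn].
    by rewrite e modnn eqxx.
  by rewrite modn_small //; case: eqP => //; lia.
have := adjS (ord_pred i); rewrite ord_predK adj_sym => pre.
have side j : adj (f i) (f j) -> l (f i) < l (f j).
  move=> /adj_neq ij; have := imin j isT.
  by rewrite leq_eqVlt val_eqE (inj_eq label_inj) (negPf ij).
have := same_side pre (adjS i); rewrite !side // => /(_ erefl).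
have e1 := le_n i; have := le_n (ord_pred i); rewrite ord_predK => e2.
rewrite /near (inj_eq f_inj) fE -val_eqE.
have ltS := ltn_ord (ordS i); have ltP := ltn_ord (ord_pred i); have ltI := ltn_ord i.
have -> /= : val (ord_pred i) == val (ordS i) = false.
  by move: e1 e2; do 2 case: eqP => /=; lia.
case: (ltngtP (ord_pred i) (ordS i)) => [lt|lt|]; last 1 first.
- by move: e1 e2; do 2 case: eqP => /=; lia.
- by rewrite cycle_adj_ltn //; move: e1 e2; do 2 case: eqP => /=; lia.
- by rewrite cycle_adj_sym cycle_adj_ltn //; move: e1 e2; do 2 case: eqP => /=; lia.
Qed.

(** Two of the three leaves are on the same side of the centre. *)
Lemma closed_claw_free : claw_free G.
Proof.
move=> /has_induced_edgesP[v [vN vE]].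
have := opposite_side (vE 0 1 isT) (vE 0 2 isT) (vN 1 2 isT) (negbT (vE 1 2 isT)).
have := opposite_side (vE 0 1 isT) (vE 0 3 isT) (vN 1 3 isT) (negbT (vE 1 3 isT)).
have := opposite_side (vE 0 2 isT) (vE 0 3 isT) (vN 2 3 isT) (negbT (vE 2 3 isT)).
by do 3 case: (_ < _).
Qed.

(** The pendant vertex at a vertex of the triangle is on the side opposite to both
other vertices of the triangle, so each vertex of the triangle would be its
minimum or its maximum, whereas one of them is in the middle. *)
Lemma closed_no_H1 : ~ has_induced H1 G.
Proof.
move=> /has_induced_edgesP[v [vN vE]].
have vE' i j ij := etrans (adj_sym (v j) (v i)) (vE i j ij).
have := opposite_side (vE 0 1 isT) (vE 0 3 isT) (vN 1 3 isT) (negbT (vE 1 3 isT)).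
have := opposite_side (vE 0 2 isT) (vE 0 3 isT) (vN 2 3 isT) (negbT (vE 2 3 isT)).
have := opposite_side (vE' 0 1 isT) (vE 1 4 isT) (vN 0 4 isT) (negbT (vE 0 4 isT)).
have := opposite_side (vE 1 2 isT) (vE 1 4 isT) (vN 2 4 isT) (negbT (vE 2 4 isT)).
have := opposite_side (vE' 0 2 isT) (vE 2 5 isT) (vN 0 5 isT) (negbT (vE 0 5 isT)).
have := opposite_side (vE' 1 2 isT) (vE 2 5 isT) (vN 1 5 isT) (negbT (vE 1 5 isT)).
rewrite (label_adj (vE 0 1 isT)) (label_adj (vE 0 2 isT)) (label_adj (vE 1 2 isT)).
by do 6 case: (_ < _).
Qed.

(** At a vertex of the triangle, the two outer neighbours are non-adjacent and
each is opposite to one of the other vertices of the triangle, so these are on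
different sides; but only the middle vertex of the triangle can be like this. *)
Lemma closed_no_H2 : ~ has_induced H2 G.
Proof.
move=> /has_induced_edgesP[v [vN vE]].
have vE' i j ij := etrans (adj_sym (v j) (v i)) (vE i j ij).
have := opposite_side (vE 0 1 isT) (vE 0 4 isT) (vN 1 4 isT) (negbT (vE 1 4 isT)).
have := opposite_side (vE 0 2 isT) (vE 0 3 isT) (vN 2 3 isT) (negbT (vE 2 3 isT)).
have := opposite_side (vE 0 3 isT) (vE 0 4 isT) (vN 3 4 isT) (negbT (vE 3 4 isT)).
have := opposite_side (vE' 0 1 isT) (vE 1 5 isT) (vN 0 5 isT) (negbT (vE 0 5 isT)).
have := opposite_side (vE 1 2 isT) (vE 1 3 isT) (vN 2 3 isT) (negbT (vE 2 3 isT)).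
have := opposite_side (vE 1 3 isT) (vE 1 5 isT) (vN 3 5 isT) (negbT (vE 3 5 isT)).
have := opposite_side (vE' 0 2 isT) (vE 2 5 isT) (vN 0 5 isT) (negbT (vE 0 5 isT)).
have := opposite_side (vE' 1 2 isT) (vE 2 4 isT) (vN 1 4 isT) (negbT (vE 1 4 isT)).
have := opposite_side (vE 2 4 isT) (vE 2 5 isT) (vN 4 5 isT) (negbT (vE 4 5 isT)).
lia.
Qed.

End Forbidden.

(** * Forbidden subgraphs as adjacency rules *)

Lemma claw_near (G : sgraph) (c x y z : G) : claw_free G ->
  adj c x -> adj c y -> adj c z -> [|| near x y, near x z | near y z].
Proof.
move=> clawF cx cy cz; apply: contra_notT clawF; rewrite /near !negb_or.
move=> /and3P[/andP[xy nxy] /andP[xz nxz] /andP[yz nyz]].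
apply/has_induced_edgesP; exists (nth c [:: c; x; y; z]); split.
  move=> i j /andP[ij]; case: j ij => [|[|[|[|j]]]] //;
    by case: i => [|[|[|i]]] //= _ _ //; apply: adj_neq.
move=> i j /andP[ij]; case: j ij => [|[|[|[|j]]]] //;
  by case: i => [|[|[|i]]] //= _ _; rewrite ?cx ?cy ?cz //; apply: negbTE.
Qed.

Lemma H1_free (G : sgraph) (a b c a' b' c' : G) : ~ has_induced H1 G ->
  adj a b -> adj a c -> adj b c -> adj a a' -> adj b b' -> adj c c' ->
  ~~ adj a b' -> ~~ adj a c' -> ~~ adj b a' -> ~~ adj b c' ->
  ~~ adj c a' -> ~~ adj c b' ->
  ~~ adj a' b' -> ~~ adj a' c' -> ~~ adj b' c' -> False.
Proof.
move=> noH1 *; apply: noH1.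
apply: (@has_induced_twin_free _ 5 _ (nth a [:: a; b; c; a'; b'; c'])) => i j /andP[ij].
  by case: j ij => [|[|[|[|[|[|j]]]]]] //; case: i => [|[|[|[|[|i]]]]].
case: j ij => [|[|[|[|[|[|j]]]]]] //;
  by case: i => [|[|[|[|[|i]]]]] //= _ _; apply: negbTE.
Qed.

Lemma H2_free (G : sgraph) (a b c u v w : G) : ~ has_induced H2 G ->
  adj a b -> adj a c -> adj b c -> adj a u -> adj b u -> adj a v -> adj c v ->
  adj b w -> adj c w ->
  ~~ adj a w -> ~~ adj b v -> ~~ adj c u ->
  ~~ adj u v -> ~~ adj u w -> ~~ adj v w -> False.
Proof.
move=> noH2 *; apply: noH2.
apply: (@has_induced_twin_free _ 5 _ (nth a [:: a; b; c; u; v; w])) => i j /andP[ij].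
  by case: j ij => [|[|[|[|[|[|j]]]]]] //; case: i => [|[|[|[|[|i]]]]].
case: j ij => [|[|[|[|[|[|j]]]]]] //;
  by case: i => [|[|[|[|[|i]]]]] //= _ _; apply: negbTE.
Qed.

(** * Induced cycles from shortest paths *)

Section Apex.
Variable G : sgraph.

Definition restrict (P : pred G) : rel G := [rel u v | [&& adj u v, P u & P v]].

Lemma restrict_sym P : symmetric (restrict P).
Proof. by move=> x y; rewrite /restrict /= adj_sym [P x && _]andbC. Qed.

Lemma connect_restrictC P x y : connect (restrict P) x y = connect (restrict P) y x.
Proof. exact/sym_connect_sym/restrict_sym. Qed.

Lemma shortest_path (T : finType) (e : rel T) a b : connect e a b ->
  exists2 p, path e a p /\ last a p = b &
    forall q, path e a q -> last a q = b -> size p <= size q.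
Proof.
move=> /connectP[p0 ap0 bE].
pose P n := [exists t : n.-tuple T, path e a t && (last a t == b)].
have PP q : path e a q -> last a q = b -> P (size q).
  by move=> aq qb; apply/existsP; exists (in_tuple q); rewrite aq qb /=.
have exP : exists n, P n by exists (size p0); apply: PP.
case: (ex_minnP exP) => n /existsP[t /andP[at_ /eqP tb]] nmin.
by exists t => // q aq qb; rewrite size_tuple nmin // PP.
Qed.

(** A repetition or a chord would give a shortcut. *)
Lemma shortest_induced (T : finType) (e : rel T) a b p : path e a p -> last a p = b ->
  (forall q, path e a q -> last a q = b -> size p <= size q) ->
  forall i j, i < j <= size p ->
  (nth a (a :: p) i != nth a (a :: p) j) /\
  (e (nth a (a :: p) i) (nth a (a :: p) j) -> j = i.+1).
Proof.
move=> ap pb pmin i j /andP[ij jp].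
have vE k : k <= size p -> last a (take k p) = nth a (a :: p) k.
  move=> kp; rewrite (last_nth a) size_takel //.
  by rewrite -[a :: take k p]/(take k.+1 (a :: p)) nth_take.
have split_at k : k <= size p -> path e a (take k p) /\
    path e (nth a (a :: p) k) (drop k p) /\ last (nth a (a :: p) k) (drop k p) = b.
  move=> kp; rewrite -vE // -last_cat; move: ap.
  by rewrite -{1}(cat_take_drop k p) cat_path => /andP[? ?]; rewrite cat_take_drop.
have ip : i <= size p by lia.
have [ai _] := split_at i ip; have [_ [bj lj]] := split_at j jp.
split; [apply/eqP=> vij | move=> vij].
  have := pmin (take i p ++ drop j p).
  rewrite cat_path last_cat vE // vij bj lj ai => /(_ isT erefl).
  by rewrite size_cat size_takel // size_drop; lia.
have := pmin (take i p ++ nth a (a :: p) j :: drop j p).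
rewrite cat_path last_cat vE // /= vij bj lj ai => /(_ isT erefl).
by rewrite size_cat size_takel //= size_drop; lia.
Qed.

(** A shortest path from [a] to [b] whose inner vertices avoid [x] and its
neighbours closes through [x] to an induced cycle, of length at least four
unless [a] and [b] are equal or adjacent. *)
Lemma chordal_apex x a b : chordal G -> adj x a -> adj x b ->
  connect (restrict [pred u | (u \in [:: a; b]) || ~~ near x u]) a b -> near a b.
Proof.
move=> chG xa xb /shortest_path[p [ap pb] pmin].
  apply: contraT; rewrite negb_or => /andP[ab nab].
  set P := [pred u | _] in ap pmin.
  pose v i := nth a (a :: p) i.
  have vP i : i <= size p -> P (v i).
    case: i => [|i] ip; first by rewrite /P /= mem_head.
    by have /and3P[] := pathP a ap i ip.
  have vb : v (size p) = b by rewrite -pb (last_nth a).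
  have v_adjS i : i < size p -> adj (v i) (v i.+1).
    by move=> ip; have /and3P[] := pathP a ap i ip.
  have v_ind i j : i < j <= size p -> (v i != v j) /\ adj (v i) (v j) = (j == i.+1).
    move=> ijp; have [vij e] := shortest_induced ap pb pmin ijp; split=> //.
    apply/idP/eqP => [adj_ij|->]; last by apply: v_adjS; lia.
    by apply: e; apply/and3P; split=> //; apply: vP; lia.
  have p2 : 1 < size p.
    move: vb; case: (size p) (v_adjS 0) => [_ e|[/(_ isT) e vb|//]].
      by rewrite -e eqxx in ab.
    by rewrite -vb e in nab.
  have xv i : i <= size p -> (x != v i) /\ adj x (v i) = (i == 0) || (i == size p).
    move=> ip; case: (posnP i) => [->|i0] /=; first by rewrite adj_neq.
    have [->|ni] := eqVneq i (size p); first by rewrite vb adj_neq.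
    have := vP i ip; rewrite /P /= !inE -vb.
    have [/negPf] := v_ind 0 i ltac:(lia); rewrite eq_sym => -> _.
    have [/negPf -> _] := v_ind i (size p) ltac:(lia).
    by rewrite negb_or => /andP[-> /negPf].
  have f_lt (i j : 'I_(size p).+2) : i < j ->
    (nth x (x :: a :: p) i != nth x (x :: a :: p) j) /\
    adj (nth x (x :: a :: p) i) (nth x (x :: a :: p) j) = cycle_adj i j.
    move=> ij; rewrite cycle_adj_ltn //; case: i j ij => [i /= ip] [[//|j] /= jp] ij.
    have nE k : k <= size p -> nth x (a :: p) k = v k.
      by move=> kp; apply: set_nth_default.
    rewrite nE //; case: i ip ij => [|i] /= ip ij.
      by have [-> ->] := xv j ltac:(lia); rewrite !eqSS.
    rewrite nE; last by lia.
    by have [-> ->] := v_ind i j ltac:(lia); rewrite orbF eqSS.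
  case: (chG (size p).+2) => //.
  apply/has_inducedP; exists (fun i : 'I_(size p).+2 => nth x (x :: a :: p) i).
    move=> i j e; apply/val_inj; case: (ltngtP i j) => // ij.
      by have [] := f_lt _ _ ij; rewrite e eqxx.
    by have [] := f_lt _ _ ij; rewrite e eqxx.
  move=> i j; case: (ltngtP i j) => [/f_lt[] //|ij|/val_inj ->].
    by rewrite adj_sym [RHS]adj_sym; have [] := f_lt _ _ ij.
  by rewrite !adj_irr.
Qed.

End Apex.

(** * Distance levels *)

(** The triangle is [x], [p], [q]; the pendant vertices are [u] at [p] and [v] at
[q]. *)
Definition bull_nose (G : sgraph) (x : G) := exists p q u v,
  [/\ adj x p, adj x q, adj p q, adj p u & adj q v] /\
  [/\ ~~ adj x u, ~~ adj x v, ~~ adj u v, ~~ adj u q & ~~ adj v p].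

Definition simplicial (G : sgraph) (x : G) :=
  forall u v, adj x u -> adj x v -> near u v.

Definition lower (G : sgraph) (d : G -> nat) (x : G) :=
  [set z | adj x z & d x == (d z).+1].

Definition upper (G : sgraph) (d : G -> nat) (x : G) :=
  [set z | adj x z & d z == (d x).+1].

(** [lia] would split on every adjacency hypothesis, hence the clearing. *)
Ltac level_lia :=
  repeat match goal with H : is_true ?b |- _ =>
    lazymatch b with leq _ _ => fail | _ => clear H end end; lia.

(** These four properties characterize [d] as the distance from [s]. *)
Definition bfs_levels (G : sgraph) (s : G) (d : G -> nat) :=
  [/\ d s = 0,
      forall y, d y = 0 -> y = s,
      forall y z, adj y z -> d z <= (d y).+1 &
      forall y, 0 < d y -> exists2 z, adj z y & d y = (d z).+1].

Lemma bfs_levels_exist (G : sgraph) (s : G) :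
  connected_graph G -> exists d, bfs_levels s d.
Proof.
move=> hG.
have /fin_all_exists[p pP] y : exists p, (path (@adj G) s p /\ last s p = y) /\
    forall q, path (@adj G) s q -> last s q = y -> size p <= size q.
  by have [p] := shortest_path (hG s y); exists p.
exists (fun y => size (p y)).
have p_adj y z : adj y z -> size (p z) <= (size (p y)).+1.
  have [[sp pl] _] := pP y; have [_ pmin] := pP z => yz.
  by rewrite -(size_rcons _ z) pmin ?last_rcons // rcons_path sp pl.
split=> // [|y p0|y p_gt0].
- by apply/eqP; have [_ /(_ [::]) /= pmin] := pP s; rewrite -leqn0 pmin.
- by have [[_ <-] _] := pP y; rewrite (size0nil p0).
have [[sp pl] _] := pP y; case/lastP pE: (p y) p_gt0 sp pl => [//|q z] _.
rewrite rcons_path last_rcons => /andP[sq qz] zy; rewrite zy in qz.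
exists (last s q) => //; have [_ /(_ q sq erefl) pmin] := pP (last s q).
by have := p_adj _ _ qz; rewrite pE size_rcons; lia.
Qed.

Lemma chordal_C4 (G : sgraph) (x y z w : G) : chordal G ->
  adj x y -> adj y z -> adj z w -> adj w x -> near x z || near y w.
Proof.
move=> chG xy yz zw wx; case: (boolP (near x z)) => //= nxz.
apply: (chordal_apex chG xy); first by rewrite adj_sym.
apply: (connect_trans (y := z)); apply/connect1/and3P; split;
  by rewrite /= ?nxz ?inE ?eqxx ?orbT.
Qed.

Section Levels.
Variables (G : sgraph) (s : G) (d : G -> nat).
Hypothesis chG : chordal G.
Hypothesis clawG : claw_free G.
Hypothesis bfs : bfs_levels s d.

Lemma level0 y : d y = 0 -> y = s. Proof. by case: bfs => _ + _ _; apply. Qed.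

Lemma level_adj y z : adj y z -> d z <= (d y).+1.
Proof. by case: bfs => _ _ + _; apply. Qed.

Lemma level_pred y : 0 < d y -> exists2 z, adj z y & d y = (d z).+1.
Proof. by case: bfs => _ _ _; apply. Qed.

Lemma far_level x y : (d x).+1 < d y -> ~~ near x y.
Proof.
move=> dxy; rewrite /near negb_or; apply/andP; split.
  by apply: contraTneq dxy => ->; lia.
by apply: contraTN dxy => /level_adj; lia.
Qed.

Lemma connect_root (P : pred G) v : P v ->
  (forall u, d u < d v -> P u) -> connect (restrict P) v s.
Proof.
have [n] := ubnP (d v); elim: n v => // n IHn v /ltnSE dv Pv Plow.
case: (posnP (d v)) => [/level0 -> //|/level_pred[u uv du]].
have Pu : P u by apply: Plow; lia.
apply: (connect_trans (y := u)).
  by apply/connect1/and3P; rewrite adj_sym.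
by apply: IHn => // [|w wu]; [|apply: Plow]; lia.
Qed.

(** Suppose [p] and [q] are not adjacent.  They are joined through the root by a
path of vertices too close to the root to be adjacent to [x] or [y].  If [x] or
[y] is adjacent to both, it is an apex for this path.  Otherwise the path
is prolonged from [q] to [y], and [x] is an apex for the result. *)
Lemma preds_near x y p q : near x y -> d x = d y -> adj x p -> adj y q ->
  d x = (d p).+1 -> d x = (d q).+1 -> near p q.
Proof.
move=> xy dxy xp yq dp dq.
have apex z : adj z p -> adj z q -> d z = d x -> near p q.
  move=> zp zq dz; apply: (chordal_apex chG zp zq).
  have far u : d u < d p -> ~~ near z u.
    by rewrite near_sym => du; apply: far_level; lia.
  apply: (connect_trans (y := s)); last rewrite connect_restrictC.
    by apply: connect_root => [|u du]; rewrite /= ?inE ?eqxx // far ?orbT.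
  by apply: connect_root => [|u du]; rewrite /= ?inE ?eqxx ?orbT // far ?orbT //; lia.
have [xq|nxq] := boolP (adj x q); first exact: (apex x).
have [yp|nyp] := boolP (adj y p); first exact: (apex y).
have {xy} xy : adj x y by case/orP: xy => // /eqP e; rewrite e yq in nxq.
have : near p y.
  apply: (chordal_apex chG xp xy).
  have far u : d u < d p -> ~~ near x u.
    by rewrite near_sym => du; apply: far_level; lia.
  apply: (connect_trans (y := s)); last rewrite connect_restrictC.
    by apply: connect_root => [|u du]; rewrite /= ?inE ?eqxx // far ?orbT.
  have nq : ~~ near x q.
    by rewrite /near negb_or nxq andbT; apply/eqP=> e; move: dq; rewrite e; lia.
  apply: (connect_trans (y := q)).
    by apply/connect1/and3P; split; rewrite //= ?inE ?eqxx ?orbT ?nq ?orbT.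
  by apply: connect_root => [|u du]; rewrite /= ?nq ?orbT // far ?orbT //; lia.
by rewrite near_sym /near (negPf nyp) orbF => /eqP e; move: dp; rewrite -e; lia.
Qed.

Lemma far_adj x y : (d x).+1 < d y -> ~~ adj x y.
Proof. by move=> /far_level; rewrite negb_or => /andP[]. Qed.

(** Otherwise [c], with [u], [v] and a lower neighbour of [c], is a claw. *)
Lemma upper_nbrs_near c u v : 0 < d c -> adj c u -> adj c v ->
  d u = (d c).+1 -> d v = (d c).+1 -> near u v.
Proof.
move=> dc cu cv du dv; have [r rc dr] := level_pred dc.
have cr : adj c r by rewrite adj_sym.
case/or3P: (claw_near clawG cu cv cr) => //; rewrite near_sym.
  by apply: contraTT => _; apply: far_level; level_lia.
by apply: contraTT => _; apply: far_level; level_lia.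
Qed.

(** Otherwise [p], with its neighbours [q], [r] and [u], is a claw. *)
Lemma pred_shared p q r u : adj p q -> d q = d p -> adj r p ->
  d p = (d r).+1 -> adj p u -> d u = (d p).+1 -> ~~ adj q u -> adj r q.
Proof.
move=> pq dq rp dr pu du nqu; have pr : adj p r by rewrite adj_sym.
have nru : ~~ near r u by apply: far_level; level_lia.
have := claw_near clawG pr pq pu; rewrite (negPf nru) /= /near (negPf nqu) orbF.
case/orP=> [/orP[/eqP e|//]|/eqP e]; last by move: dq; rewrite e; level_lia.
by move: dr; rewrite e; level_lia.
Qed.

(** For [d u = 1] this is simpliciality.  Above, lower neighbours [p] of [u] and
[q] of [v] have a common lower neighbour [r]: the triangle [p], [q], [r] with
pendants [u] and [v] is a bull with nose [r], and, if [r] is not the root, a net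
with a lower neighbour of [r] as third pendant. *)
Lemma levels_cliques : ~ has_induced H1 G -> simplicial s -> ~ bull_nose s ->
  forall u v, d u = d v -> near u v.
Proof.
move=> noH1 simp nobull u v.
have [n] := ubnP (d u); elim: n u v => // n IHn u v /ltnSE dn duv.
apply: contraT => nuv; move: (nuv); rewrite negb_or => /andP[uv nadj_uv].
have [du0|du] := posnP (d u).
  by move: uv; rewrite (level0 du0) (@level0 v) ?eqxx -?duv.
have [p pu dp] := level_pred du.
have [q qv dq] : exists2 q, adj q v & d v = (d q).+1 by apply: level_pred; rewrite -duv.
have [dp0|dp_gt0] := posnP (d p).
  have e : q = p by rewrite (level0 dp0); apply: level0; level_lia.
  by rewrite {q}e in qv dq *; rewrite (level0 dp0) in pu qv; rewrite simp in nuv.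
have npv : ~~ adj p v.
  by apply: contra nuv => pv; apply: (upper_nbrs_near dp_gt0 pu pv); level_lia.
have nqu : ~~ adj q u.
  apply: contra nuv => qu; have dq_gt0 : 0 < d q by level_lia.
  by apply: (upper_nbrs_near dq_gt0 qu qv); level_lia.
have pq : adj p q.
  apply: near_adj; last by apply: IHn; level_lia.
  by apply: contraNneq npv => ->.
have [r rp dr] := level_pred dp_gt0.
have rq : adj r q by apply: (pred_shared pq _ rp dr pu dp nqu); level_lia.
have nru : ~~ adj r u by apply: far_adj; level_lia.
have nrv : ~~ adj r v by apply: far_adj; level_lia.
have [dr0|dr_gt0] := posnP (d r).
  rewrite (level0 dr0) in rp rq nru nrv *.
  by case: nobull; exists p, q, u, v; rewrite [adj u q]adj_sym [adj v p]adj_sym.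
have [w wr dw] := level_pred dr_gt0.
exfalso; apply: (H1_free noH1 rp rq pq _ pu qv) => //.
  by rewrite adj_sym; exact: wr.
all: by rewrite 1?[adj _ w]adj_sym //; apply: far_adj; level_lia.
Qed.

(** An induced path [x], [y], [z] in a level gives a sun.  By the claw at [y], a
lower neighbour [p] of [y] is adjacent to one end, say [z], and not to the other
by [upper_nbrs_near]; a lower neighbour [q] of [x] is adjacent to [p], hence to
[y] by the 4-cycle rule.  The sun has centre [y], [p], [q] and outer vertices
[z], [x] and a common lower neighbour [r] of [p] and [q].  The bound on [d y]
provides [r]. *)
Lemma same_level_trans : ~ has_induced H2 G ->
  forall x y z, 1 < d y -> d x = d y -> d z = d y -> adj y x -> adj y z -> near x z.
Proof.
move=> noH2 x y z dy1 dx dz yx yz; apply: contraT => nxz.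
have [p py dp] : exists2 p, adj p y & d y = (d p).+1 by apply: level_pred; level_lia.
have yp : adj y p by rewrite adj_sym.
have dp_gt0 : 0 < d p by level_lia.
wlog pz : x z dx dz yx yz nxz / adj p z.
  move=> wl; have := claw_near clawG yx yz yp; rewrite (negPf nxz) /=.
  have pE u : d u = d y -> near u p -> adj p u.
    move=> du; rewrite near_sym; apply: near_adj; apply/eqP=> e.
    by move: dp; rewrite e; level_lia.
  case/orP => /pE h; last by apply: (wl x z); rewrite ?h.
  by apply: (wl z x); rewrite ?h // near_sym.
have npx : ~~ adj p x.
  by apply: contra nxz => px; apply: (upper_nbrs_near dp_gt0 px pz); level_lia.
have [q qx dq] : exists2 q, adj q x & d x = (d q).+1 by apply: level_pred; level_lia.
have nqz : ~~ adj q z.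
  by apply: contra nxz => qz; apply: (upper_nbrs_near _ qx qz); level_lia.
have pq : adj p q.
  apply: near_adj; first by apply: contraNneq npx => ->.
  by apply: (@preds_near y x); rewrite // 1?adj_sym // /near ?yx ?orbT //; level_lia.
have yq : adj y q.
  have xy : adj x y by rewrite adj_sym.
  have := chordal_C4 chG xy yp pq qx; rewrite near_sym {1}/near (negPf npx) orbF.
  case/orP => [/eqP e|]; first by move: dp; rewrite e; level_lia.
  by apply: near_adj; apply/eqP=> e; move: dq; rewrite -e; level_lia.
have [r rp dr] := level_pred dp_gt0.
have rq : adj r q by apply: (pred_shared pq _ rp dr pz _ nqz); level_lia.
move: nxz; rewrite negb_or => /andP[_ nxz].
exfalso; apply: (H2_free noH2 yp yq pq yz pz yx qx (w := r)) => //.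
all: by rewrite 1?[adj z x]adj_sym 1?[adj _ r]adj_sym // far_adj //; level_lia.
Qed.

End Levels.

(** * A root at the far end of the graph *)

Section Deepest.
Variables (G : sgraph) (t s : G) (d : G -> nat).
Hypothesis chG : chordal G.
Hypothesis clawG : claw_free G.
Hypothesis noH2 : ~ has_induced H2 G.
Hypothesis bfs : bfs_levels t d.
Hypothesis deepest : forall x, d x <= d s.
Hypothesis s_gt1 : 1 < d s.
Hypothesis s_min : forall x, d x = d s -> #|lower d s| <= #|lower d x|.

Let trans := same_level_trans chG clawG bfs noH2.
Let predN := preds_near chG bfs.

Lemma deepest_nbr_level x : adj s x -> d x = d s \/ d s = (d x).+1.
Proof. by rewrite adj_sym => /(level_adj bfs); have := deepest x; level_lia. Qed.

(** Lower neighbourhoods of adjacent vertices of a level are nested, an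
incomparable pair giving an induced 4-cycle; that of [s] is the smallest. *)
Lemma deepest_lower_sub x p : d x = d s -> adj s x -> adj s p ->
  d s = (d p).+1 -> adj x p.
Proof.
move=> dx sx sp dp; apply: contraT => nxp.
have xs : adj x s by rewrite adj_sym.
have pNs : p \in lower d s by rewrite inE sp dp /=.
have pNx : p \notin lower d x by rewrite inE (negPf nxp).
have : #|lower d x| < #|lower d s|.
  apply: proper_card; rewrite properE; apply/andP; split; last first.
    by apply/subsetPn; exists p.
  apply/subsetP=> q; rewrite !inE => /andP[xq /eqP dq]; rewrite -dx dq eqxx andbT.
  have pq : near p q by apply: (@predN s x); rewrite // /near ?sx ?orbT //; level_lia.
  have {}pq : adj p q by apply: near_adj pq; apply: contraNneq nxp => ->.
  have qx : adj q x by rewrite adj_sym.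
  have := chordal_C4 chG sp pq qx xs; rewrite [near p x]near_sym /near (negPf nxp) orbF.
  case/orP=> [/orP[/eqP e|//]|/eqP e]; first by move: dq; rewrite -e; level_lia.
  by move: dp; rewrite -e; level_lia.
by rewrite ltnNge s_min.
Qed.

Lemma deepest_simplicial : simplicial s.
Proof.
move=> u v su sv.
case: (deepest_nbr_level su) (deepest_nbr_level sv) => du [] dv.
- exact: (trans (y := s)).
- by rewrite /near (deepest_lower_sub (x := u)) ?orbT.
- by rewrite near_sym /near (deepest_lower_sub (x := v)) ?orbT.
by apply: (@predN s s); rewrite // /near eqxx.
Qed.

(** If [x] were in the level of [s], then [a] would be a lower neighbour of [x];
by [preds_near] it would be equal or adjacent to [b], if [y] is in that level
too, or else to [y], and the hypotheses exclude both. *)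
Lemma bull_base_lower x y a b : adj s x -> adj s y -> adj x y -> adj x a ->
  adj y b -> ~~ adj s a -> ~~ adj s b -> ~~ adj a b -> ~~ adj a y ->
  ~~ adj b x -> d s = (d x).+1.
Proof.
move=> sx sy xy xa yb nsa nsb nab nay nbx.
have [dx|//] := deepest_nbr_level sx.
have level_low z c : d z = d s -> adj s z -> adj z c -> s != c -> ~~ adj s c ->
    d s = (d c).+1.
  move=> dz sz zc sc nsc; have dc : d c <> d s.
    move=> dc; move/negP: nsc; apply; apply: (near_adj sc).
    by apply: (@trans s z c); rewrite ?dz // adj_sym.
  by move: zc; rewrite adj_sym => /(level_adj bfs); have := deepest c; level_lia.
have sa : s != a by apply: contraNneq nay => <-.
have sb : s != b by apply: contraNneq nbx => <-.
have da := level_low x a dx sx xa sa nsa.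
have [dy|dy] := deepest_nbr_level sy.
  have db := level_low y b dy sy yb sb nsb.
  have near_xy : near x y by rewrite /near xy orbT.
  have := predN near_xy (etrans dx (esym dy)) xa yb; rewrite /near (negPf nab) orbF.
  move=> /(_ ltac:(level_lia) ltac:(level_lia)) /eqP e.
  by rewrite e adj_sym yb in nay.
have near_xx : near x x by rewrite /near eqxx.
have := predN near_xx erefl xa xy; rewrite /near (negPf nay) orbF.
move=> /(_ ltac:(level_lia) ltac:(level_lia)) /eqP e.
by rewrite e sy in nsa.
Qed.

(** Both base vertices [p], [q] of a bull with nose [s] are lower neighbours of
[s]; by the 4-cycle rule they have a common lower neighbour [r], which
claw-freeness at [p] and at [q] joins to the pendants [u] and [v].  This is a sun
with centre [p], [q], [r] and outer vertices [s], [u], [v]. *)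
Lemma deepest_not_nose : ~ bull_nose s.
Proof.
case=> p [q [u [v [[sp sq pq pu qv] [nsu nsv nuv nuq nvp]]]]].
have dp := bull_base_lower sp sq pq pu qv nsu nsv nuv nuq nvp.
have dq : d s = (d q).+1.
  by apply: (bull_base_lower (x := q) (y := p) (a := v) (b := u)); rewrite // adj_sym.
have [r pr [qr dr]] : exists2 r, adj p r & adj q r /\ d p = (d r).+1.
  have [a ap da] : exists2 a, adj a p & d p = (d a).+1.
    by apply: (level_pred bfs); level_lia.
  have [b bq db] : exists2 b, adj b q & d q = (d b).+1.
    by apply: (level_pred bfs); level_lia.
  have pa : adj p a by rewrite adj_sym.
  have qb : adj q b by rewrite adj_sym.
  have : near a b by apply: (@predN p q); rewrite // /near ?pq ?orbT //; level_lia.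
  case/orP=> [/eqP e|ab]; first by exists a => //; split=> //; rewrite e.
  have ba : adj b a by rewrite adj_sym.
  have := chordal_C4 chG pq qb ba ap; case/orP=> /orP[/eqP e|h].
  - by move: db; rewrite -e; level_lia.
  - by exists b; rewrite //; split=> //; level_lia.
  - by move: da; rewrite -e; level_lia.
  by exists a.
have nsr : ~~ near s r by rewrite near_sym; apply: (far_level bfs); level_lia.
have ur : adj u r.
  apply: near_adj; first by apply: contraNneq nuq => ->; rewrite adj_sym.
  have ps : adj p s by rewrite adj_sym.
  have := claw_near clawG ps pu pr; rewrite (negPf nsr) /= {1}/near (negPf nsu) orbF.
  by case/orP=> // /eqP e; rewrite -e sq in nuq.
have vr : adj v r.
  apply: near_adj; first by apply: contraNneq nvp => ->; rewrite adj_sym.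
  have qs : adj q s by rewrite adj_sym.
  have := claw_near clawG qs qv qr; rewrite (negPf nsr) /= {1}/near (negPf nsv) orbF.
  by case/orP=> // /eqP e; rewrite -e sp in nvp.
move: nsr; rewrite negb_or => /andP[_ nsr].
by apply: (H2_free noH2 pq pr qr (u := s) (v := u) (w := v)); rewrite // adj_sym.
Qed.

End Deepest.

Lemma good_root_exists (G : sgraph) (t w : G) :
  connected_graph G -> chordal G -> claw_free G -> ~ has_induced H2 G ->
  ~~ near t w -> exists2 s : G, simplicial s & ~ bull_nose s.
Proof.
move=> hG chG clawG noH2 ntw; have [d bfs] := bfs_levels_exist t hG.
have [m _ dmax] := @arg_maxnP G t predT d isT.
have m2 : 1 < d m.
  apply: leq_trans (dmax w isT); rewrite ltnNge; apply: contra ntw => dw.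
  have [/(level0 bfs) ->|/(level_pred bfs)[z zw dz]] := posnP (d w).
    by rewrite /near eqxx.
  by rewrite /near -(@level0 _ _ _ bfs z) ?zw ?orbT; level_lia.
have [s /eqP ds smin] :=
  @arg_minnP G m (fun x => d x == d m) (fun x => #|lower d x|) (eqxx _).
have deep x : d x <= d s by rewrite ds; apply: dmax.
have s2 : 1 < d s by rewrite ds.
have s_min x : d x = d s -> #|lower d s| <= #|lower d x|.
  by move=> dx; apply: smin; rewrite dx ds.
by exists s; [apply: (deepest_simplicial chG clawG noH2 bfs)
  | apply: (deepest_not_nose chG clawG noH2 bfs)].
Qed.

(** * Ordering the vertices by level and rank *)

Section Order.
Variables (G : sgraph) (s : G) (d : G -> nat).
Hypothesis chG : chordal G.
Hypothesis clawG : claw_free G.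
Hypothesis bfs : bfs_levels s d.
Hypothesis cliques : forall u v, d u = d v -> near u v.

(** Inside a level this orders by the difference of the upper and lower degrees,
shifted by [#|G|] to stay in [nat]. *)
Definition rank x := #|upper d x| + (#|G| - #|lower d x|).

(** Otherwise [x], [z], [z'], [y] is an induced 4-cycle. *)
Lemma level_nbrs_nested x y z z' : d x = d y -> d z = d z' -> d z != d x ->
  adj x z -> adj y z' -> ~~ adj y z -> adj x z'.
Proof.
move=> dxy dzz dzx xz yz' nyz; apply: contraT => nxz'.
have xy : adj y x by apply: near_adj; [apply: contraNneq nyz => ->|apply: cliques].
have zz : adj z z' by apply: near_adj; [apply: contraNneq nyz => ->|apply: cliques].
have zy : adj z' y by rewrite adj_sym.
have := chordal_C4 chG xz zz zy xy.
rewrite [near z y]near_sym /near (negPf nxz') (negPf nyz) !orbF.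
by case/orP=> /eqP e; move: dzx; [rewrite dzz e eqxx|rewrite dxy e eqxx].
Qed.

(** Otherwise [x], with [y], [z] and [p], is a claw. *)
Lemma up_dn_opposite x y z p : d x = d y -> d z = (d x).+1 -> d x = (d p).+1 ->
  adj x z -> adj x p -> ~~ adj y z -> adj y p.
Proof.
move=> dxy dz dp xz xp nyz.
have xy : adj x y.
  by rewrite adj_sym; apply: near_adj; [apply: contraNneq nyz => ->|apply: cliques].
have npz : ~~ near p z by apply: (far_level bfs); level_lia.
have := claw_near clawG xp xy xz.
rewrite (negPf npz) near_sym /= [near y z]/near (negPf nyz) orbF.
case/orP=> [|/eqP e]; last by move: dz; rewrite -e; level_lia.
by apply: near_adj; apply/eqP=> e; move: dp; rewrite -e; level_lia.
Qed.

(** If [y] missed [z], then, by nestedness and opposition, [y] would have fewer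
upper neighbours than [x] and at least as many lower ones. *)
Lemma up_mono x y z : d x = d y -> rank x <= rank y ->
  adj x z -> d z = (d x).+1 -> adj y z.
Proof.
move=> dxy rxy xz dz; apply: contraLR rxy => nyz; rewrite -ltnNge.
have lt_up : #|upper d y| < #|upper d x|.
  apply: proper_card; rewrite properE; apply/andP; split; last first.
    by apply/subsetPn; exists z; rewrite !inE ?xz ?dz ?(negPf nyz) //=.
  apply/subsetP=> z'; rewrite !inE dxy => /andP[yz' /eqP dz']; rewrite dz' eqxx andbT.
  by apply: (@level_nbrs_nested x y z) => //; level_lia.
have le_dn : #|lower d x| <= #|lower d y|.
  apply/subset_leq_card/subsetP=> p; rewrite !inE dxy => /andP[xp /eqP dp].
  by rewrite dp eqxx andbT; apply: (@up_dn_opposite x y z); rewrite // dxy.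
by have := max_card (lower d y); rewrite /rank; level_lia.
Qed.

Lemma dn_mono x y p : d x = d y -> rank x <= rank y ->
  adj y p -> d y = (d p).+1 -> adj x p.
Proof.
move=> dxy rxy yp dp; apply: contraLR rxy => nxp; rewrite -ltnNge.
have lt_dn : #|lower d x| < #|lower d y|.
  apply: proper_card; rewrite properE; apply/andP; split; last first.
    by apply/subsetPn; exists p; rewrite !inE ?yp ?dp ?(negPf nxp) //=.
  apply/subsetP=> p'; rewrite !inE dxy => /andP[xp' /eqP dp']; rewrite dp' eqxx andbT.
  by apply: (@level_nbrs_nested y x p) => //; level_lia.
have le_up : #|upper d y| <= #|upper d x|.
  apply/subset_leq_card/subsetP=> z; rewrite !inE dxy => /andP[yz /eqP dz].
  rewrite dz eqxx andbT; apply: contraT => nxz.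
  by rewrite (@up_dn_opposite y x z p) in nxp.
by have := max_card (lower d y); rewrite /rank; level_lia.
Qed.

Definition before x y := (d x < d y) || (d x == d y) && (rank x <= rank y).

Lemma before_total : total before.
Proof. by move=> x y; rewrite /before; lia. Qed.

Lemma before_trans : transitive before.
Proof. by move=> y x z; rewrite /before; lia. Qed.

Lemma before_umbrella x y z : before x y -> before y z -> adj x z ->
  near x y /\ near y z.
Proof.
move=> xy yz xz; have dz := level_adj bfs xz.
have := xy; have := yz; rewrite /before.
case/orP=> [dyz|/andP[/eqP dyz ryz]]; case/orP=> [dxy|/andP[/eqP dxy rxy]].
- by level_lia.
- by rewrite cliques // /near (up_mono dxy rxy xz) ?orbT //; level_lia.
- split; last exact: cliques.
  have zx : adj z x by rewrite adj_sym.
  by rewrite near_sym /near (dn_mono dyz ryz zx) ?orbT //; level_lia.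
by split; apply: cliques.
Qed.

End Order.

Lemma labeling_of_order (G : finType) (le : rel G) : total le -> transitive le ->
  exists l : G -> 'I_#|G|, bijective l /\ forall x y, l x < l y -> le x y.
Proof.
move=> le_total le_trans; pose o := sort le (enum G).
have mem_o x : x \in o by rewrite mem_sort mem_enum.
have idx x : index x o < #|G| by rewrite cardE -(size_sort le) index_mem.
exists (fun x => Ordinal (idx x)); split.
  apply: inj_card_bij; last by rewrite card_ord.
  by move=> x y [e]; rewrite -(nth_index x (mem_o x)) e nth_index.
move=> x y /= xy; apply: (sorted_ltn_index le_trans _) xy;
  by [apply: sort_sorted | apply: mem_o].
Qed.

Lemma closed_of_umbrella (G : sgraph) (le : rel G) : total le -> transitive le ->
  (forall x y z, le x y -> le y z -> adj x z -> near x y /\ near y z) -> closed_graph G.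
Proof.
move=> tot trans umb; have [l [l_bij l_le]] := labeling_of_order tot trans.
exists l; split=> // x y z /orP[]/andP[xy yz] _ xz.
  apply: near_adj; first by apply: contraTneq yz => ->; rewrite ltnn.
  by have [] := umb x y z (l_le _ _ xy) (l_le _ _ yz) xz.
rewrite adj_sym; apply: near_adj; first by apply: contraTneq xy => ->; rewrite ltnn.
by have [] := umb z y x (l_le _ _ xy) (l_le _ _ yz); rewrite 1?adj_sym.
Qed.

Theorem theorem2p2 (G : sgraph) (hG : connected_graph G) :
  closed_graph G <->
  [/\ chordal G, claw_free G, ~ has_induced H1 G & ~ has_induced H2 G].
Proof.
split=> [[l cl]|[chG clawG noH1 noH2]].
  by split; [apply: closed_chordal cl | apply: closed_claw_free cl
    | apply: closed_no_H1 cl | apply: closed_no_H2 cl].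
have [/forallP complete|] := boolP [forall x : G, forall y : G, near x y].
  by apply: (@closed_of_umbrella G (fun _ _ => true)) => // x y z _ _ _;
    split; apply: (forallP (complete _)).
case/forallPn=> t /forallPn[w ntw].
have [s simp nobull] := good_root_exists hG chG clawG noH2 ntw.
have [d bfs] := bfs_levels_exist s hG.
have cliques := levels_cliques clawG bfs noH1 simp nobull.
apply: closed_of_umbrella (before_total d) (@before_trans G d) _.
exact: (before_umbrella chG clawG bfs cliques).
Qed.
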